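(* For the two-user discrete memoryless multiple access channel with state $(\mathcal{X}_1,\mathcal{X}_2,\mathcal{S},\mathcal{Y},P(y|x_1,x_2,s))$, with the state sequence known non-causally at both encoders and perfect causal output feedback to both encoders, every achievable rate pair $(R_1,R_2)$ lies in $\mathcal{R}_o^{MAC}$, the set of all rate pairs for which there exist random variables $(S,V_1,V_2,X_1,X_2,Y)$ with joint distribution $P(s)P(v_1,v_2,x_1,x_2|s)P(y|x_1,x_2,s)$ (for some conditional distribution $P(v_1,v_2,x_1,x_2|s)$) such that $$R_1\le I(V_1;Y|V_2)-I(V_1;S|V_2),\qquad R_2\le I(V_2;Y|V_1)-I(V_2;S|V_1),$$ $$R_1+R_2\le I(V_1,V_2;Y)-I(V_1,V_2;S).$$ That is, $\mathcal{C}_{fb,nc}^{MAC}\subseteq\mathcal{R}_o^{MAC}$.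
   Context: The channel is memoryless: $P(y^n|x_1^n,x_2^n,s^n)=\prod_{k=1}^n P(y_k|x_{1,k},x_{2,k},s_k)$ and $P(s^n)=\prod_{k=1}^n P(s_k)$. An $(R_1,R_2,n)$ code with feedback and non-causal state information consists of encoding functions $f_{i,k}:\{1,\dots,2^{nR_i}\}\times\mathcal{S}^n\times\mathcal{Y}^{k-1}\to\mathcal{X}_i$, $i=1,2$, $k=1,\dots,n$, with channel input $x_{i,k}=f_{i,k}(w_i,s^n,y^{k-1})$, and a decoding function $g:\mathcal{Y}^n\to\{1,\dots,2^{nR_1}\}\times\{1,\dots,2^{nR_2}\}$. Messages $(w_1,w_2)$ are independent, uniform, and independent of $S^n$; $P_e$ is the average error probability. A rate pair is achievable if there is a sequence of such codes with $P_e\to0$. $\mathcal{C}_{fb,nc}^{MAC}$ is the closure of the set of achievable rate pairs. $V_1,V_2$ are auxiliary random variables (alphabets not restricted). *)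

(* Defs.v *)
From HB Require Import structures.
From mathcomp Require Import all_boot all_order all_algebra.
From mathcomp Require Import all_classical all_reals all_analysis.
Set Implicit Arguments. Unset Strict Implicit. Unset Printing Implicit Defensive.
Import Order.TTheory GRing.Theory Num.Theory.
Import numFieldNormedType.Exports.
Local Open Scope ring_scope.
Local Open Scope classical_set_scope.

(* logarithm base 2 (rates are in bits: 2^{nR} messages); ln 0 = 0 so 0 log 0 = 0 *)
Definition log2 {R : realType} (x : R) : R := ln x / ln 2.

Definition is_pmf {R : realType} {T : finType} (p : T -> R) : Prop :=
  (forall t, 0 <= p t) /\ \sum_(t : T) p t = 1.

Definition is_channel {R : realType} {X1 X2 S Y : finType}
  (W : X1 -> X2 -> S -> Y -> R) : Prop :=
  forall x1 x2 s, is_pmf (W x1 x2 s).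

Definition marg {R : realType} {T A : finType} (p : T -> R) (f : T -> A) (a : A) : R :=
  \sum_(t : T | f t == a) p t.

Definition entropy {R : realType} {T A : finType} (p : T -> R) (f : T -> A) : R :=
  - \sum_(a : A) marg p f a * log2 (marg p f a).

Definition cmi {R : realType} {T A B C : finType} (p : T -> R)
  (fa : T -> A) (fb : T -> B) (fc : T -> C) : R :=
  entropy p (fun t => (fa t, fc t)) + entropy p (fun t => (fb t, fc t))
  - entropy p (fun t => (fa t, fb t, fc t)) - entropy p fc.

Definition mi {R : realType} {T A B : finType} (p : T -> R)
  (fa : T -> A) (fb : T -> B) : R := cmi p fa fb (fun _ => tt).

(* An (M1,M2,n) code with output feedback and non-causal state at both encoders:
   x_{i,k} = f_{i,k}(w_i, s^n, y^{k-1}),  decoder g : Y^n -> messages. *)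
Record fbcode (X1 X2 S Y : finType) (n M1 M2 : nat) := FBCode {
  enc1 : forall k : 'I_n, 'I_M1 -> {ffun 'I_n -> S} -> {ffun 'I_k -> Y} -> X1;
  enc2 : forall k : 'I_n, 'I_M2 -> {ffun 'I_n -> S} -> {ffun 'I_k -> Y} -> X2;
  dec : {ffun 'I_n -> Y} -> 'I_M1 * 'I_M2 }.
Arguments enc1 {X1 X2 S Y n M1 M2} _ k _ _ _.
Arguments enc2 {X1 X2 S Y n M1 M2} _ k _ _ _.
Arguments dec {X1 X2 S Y n M1 M2} _ _.

(* y^{k-1} : the first k outputs (indices 0..k-1) of y^n *)
Definition past {Y : finType} {n : nat} (y : {ffun 'I_n -> Y}) (k : 'I_n) :
  {ffun 'I_k -> Y} := [ffun j : 'I_k => y (widen_ord (ltnW (ltn_ord k)) j)].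

Definition err_prob {R : realType} {X1 X2 S Y : finType} (PS : S -> R)
  (W : X1 -> X2 -> S -> Y -> R) {n M1 M2 : nat} (c : fbcode X1 X2 S Y n M1 M2) : R :=
  ((M1 * M2)%:R)^-1 *
  \sum_(w1 : 'I_M1) \sum_(w2 : 'I_M2) \sum_(s : {ffun 'I_n -> S})
    (\prod_(k : 'I_n) PS (s k)) *
    \sum_(y : {ffun 'I_n -> Y})
      (\prod_(k : 'I_n) W (enc1 c k w1 s (past y k)) (enc2 c k w2 s (past y k)) (s k) (y k))
      * (dec c y != (w1, w2))%:R.

Definition nmsg {R : realType} (n : nat) (r : R) : nat :=
  `|Num.ceil ((2 : R) `^ (n%:R * r))|%N.

Definition achievable {R : realType} {X1 X2 S Y : finType} (PS : S -> R)
  (W : X1 -> X2 -> S -> Y -> R) (r1 r2 : R) : Prop :=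
  exists c : forall n : nat, fbcode X1 X2 S Y n (nmsg n r1) (nmsg n r2),
    forall eps : R, 0 < eps -> exists N : nat, forall n : nat, (N <= n)%N ->
      err_prob PS W (c n) <= eps.

Definition capacity_region {R : realType} {X1 X2 S Y : finType} (PS : S -> R)
  (W : X1 -> X2 -> S -> Y -> R) : set (R * R) :=
  closure [set r | achievable PS W r.1 r.2].

Definition outer_region {R : realType} {X1 X2 S Y : finType} (PS : S -> R)
  (W : X1 -> X2 -> S -> Y -> R) : set (R * R) :=
  [set r | exists (V1 V2 : finType) (Q : S -> (V1 * V2 * X1 * X2)%type -> R),
    (forall s, is_pmf (Q s)) /\
    let p := fun t : (S * V1 * V2 * X1 * X2 * Y)%type =>
      let '(s, v1, v2, x1, x2, y) := t in PS s * Q s (v1, v2, x1, x2) * W x1 x2 s y in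
    let rS := fun t : (S * V1 * V2 * X1 * X2 * Y)%type => t.1.1.1.1.1 in
    let rV1 := fun t : (S * V1 * V2 * X1 * X2 * Y)%type => t.1.1.1.1.2 in
    let rV2 := fun t : (S * V1 * V2 * X1 * X2 * Y)%type => t.1.1.1.2 in
    let rY := fun t : (S * V1 * V2 * X1 * X2 * Y)%type => t.2 in
    let rV12 := fun t => (rV1 t, rV2 t) in
    [/\ r.1 <= cmi p rV1 rY rV2 - cmi p rV1 rS rV2,
        r.2 <= cmi p rV2 rY rV1 - cmi p rV2 rS rV1 &
        r.1 + r.2 <= mi p rV12 rY - mi p rV12 rS]].

(* Main.v *)
(* Write G(V) = I(V;Y) - I(V;S) for a single auxiliary variable V and let G* be
   its maximum. The maximum exists: up to H(S), G is H(Y) plus a sum of a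
   1-homogeneous function over the unnormalized laws of the input and state given
   V = v, so Caratheodory's argument bounds the alphabet of V and compactness
   applies.

   Every rate pair with r1, r2, r1 + r2 <= G* is in the outer region. Split V by
   a one-time pad: V2 is uniform on Z/d and independent of everything, and
   V1 = V + V2. Then G(V1) = G(V2) = 0 and G(V1, V2) = G(V), while
   I(V1;Y|V2) - I(V1;S|V2) = G(V1, V2) - G(V2), and likewise with the indices
   exchanged.

   Conversely, for a code of length n put V_k = (W1, W2, Y^(k-1), S_(k+1)^n).
   The difference H(V_k, S_k) - H(V_k, Y_k) telescopes over k, and
   sum_k G(V_k) = sum_k H(Y_k) + H(W) - H(W, Y^n) >= (1 - Pe) log M - 1, so some
   V_k satisfies n G(V_k) >= (1 - Pe) log M - 1. Thus achievable rates satisfy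
   max(r1,0) + max(r2,0) <= G*, a closed condition. *)
Require Import Defs.
From HB Require Import structures.
From mathcomp Require Import all_boot all_order all_algebra.
From mathcomp Require Import all_classical all_reals all_analysis.
From mathcomp Require Import ring lra zify.
Import Order.TTheory GRing.Theory Num.Theory.
Import numFieldNormedType.Exports.
Local Open Scope ring_scope.
Local Open Scope classical_set_scope.
Set Implicit Arguments. Unset Strict Implicit. Unset Printing Implicit Defensive.

(** * Entropy and Gibbs' inequality *)

Section Entropy.
Context {R : realType}.
Implicit Types x y : R.

Definition nxlogx x : R := - (x * log2 x).

Lemma ln2_gt0 : 0 < ln 2 :> R.
Proof. by rewrite ln_gt0// ltr1n. Qed.

Lemma log2M x y : 0 < x -> 0 < y -> log2 (x * y) = log2 x + log2 y.
Proof. by move=> x0 y0; rewrite /log2 lnM ?posrE// mulrDl. Qed.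

Lemma log2V x : 0 < x -> log2 x^-1 = - log2 x.
Proof. by move=> x0; rewrite /log2 lnV ?posrE// mulNr. Qed.

Lemma log2_prod (I : finType) (F : I -> R) :
  (forall i, 0 < F i) -> log2 (\prod_i F i) = \sum_i log2 (F i).
Proof.
move=> F0.
suff [] : 0 < \prod_i F i /\ log2 (\prod_i F i) = \sum_i log2 (F i) by [].
elim/big_ind2 : _ => [|x1 x2 y1 y2 [x10 <-] [y10 <-]|i _]; last by [].
- by rewrite /log2 ln1 mul0r.
- by rewrite mulr_gt0// log2M// addrC.
Qed.

Lemma nxlogx0 : nxlogx 0 = 0.
Proof. by rewrite /nxlogx mul0r oppr0. Qed.

(** The product rule survives at zero since [nxlogx 0 = 0]; it is the source of the homogeneity of
    [excess]. *)
Lemma nxlogxM x y : 0 <= x -> 0 <= y -> nxlogx (x * y) = x * nxlogx y + y * nxlogx x.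
Proof.
rewrite le_eqVlt => /predU1P[<- _|x0]; first by rewrite !(mul0r, nxlogx0, mulr0, addr0).
rewrite le_eqVlt => /predU1P[<-|y0]; first by rewrite !(mul0r, nxlogx0, mulr0, addr0).
by rewrite /nxlogx log2M//; ring.
Qed.

(** With [s = Num.sqrt x] and [x > 0], [x * ln x] is [2 * s * (s * ln s)], and [ln s^-1 < s^-1]
    bounds the last factor. This is the squeeze that gives continuity at 0. *)
Lemma normr_mul_ln_le x : x < 1 -> `|x * ln x| <= 2 * Num.sqrt x.
Proof.
move=> x1; have [x0|x0] := leP x 0.
  by rewrite (ln0 x0) mulr0 normr0 mulr_ge0// sqrtr_ge0.
have s0 : 0 < Num.sqrt x by rewrite sqrtr_gt0.
rewrite normrM gtr0_norm// ler0_norm; last by rewrite ln_le0// ltW.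
rewrite -{1 2}(sqr_sqrtr (ltW x0)) expr2 lnM ?posrE//.
have : ln (Num.sqrt x)^-1 < (Num.sqrt x)^-1 by rewrite ln_sublinear// invr_gt0.
rewrite lnV ?posrE// => /ltW h.
have : Num.sqrt x * (- ln (Num.sqrt x)) <= 1.
  by rewrite -(mulfV (lt0r_neq0 s0)) ler_pM2l.
by nra.
Qed.

Lemma continuous_mul_ln : continuous (fun x : R => x * ln x).
Proof.
move=> x; have [x0|x0|->] := ltgtP x 0.
- have e : {near x, (fun=> 0) =1 (fun y : R => y * ln y)}.
    near=> y; rewrite ln0 ?mulr0//; near: y.
    by apply: lt_le_nbhsl x0.
  rewrite /continuous_at ln0 ?mulr0; last exact/ltW.
  apply: (cvg_trans (near_eq_cvg e)); exact: cvg_cst.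
- by apply: cvgM; [exact: cvg_id|exact: continuous_ln].
- rewrite /continuous_at mul0r; apply/norm_cvg0P.
  have c0 : (fun=> 0) y @[y --> (0 : R)] --> (0 : R) by exact: cvg_cst.
  have c1 : 2 * Num.sqrt y @[y --> (0 : R)] --> (0 : R).
    have : 2 * Num.sqrt y @[y --> (0 : R)] --> 2 * Num.sqrt (0 : R).
      by apply: cvgM; [exact: cvg_cst|exact: sqrt_continuous].
    by rewrite sqrtr0 mulr0.
  apply: squeeze_cvgr c0 c1; near=> y.
  rewrite normr_ge0/= normr_mul_ln_le//.
  by near: y; exact: lt_nbhsl.
Unshelve. all: by end_near. Qed.

Lemma continuous_nxlogx : continuous nxlogx.
Proof.
move=> x; rewrite /nxlogx; apply: cvgN.
rewrite [X in X @ _ --> _](_ : _ = fun x => x * ln x * (ln 2)^-1); last first.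
  by apply/funext => y; rewrite /log2 mulrA.
rewrite /log2 mulrA.
by apply: cvgMl; exact: continuous_mul_ln.
Qed.

Lemma entropy_nxlogx (T A : finType) (p : T -> R) (f : T -> A) :
  entropy p f = \sum_a nxlogx (marg p f a).
Proof. by rewrite /entropy -sumrN. Qed.

Lemma entropyE (T A : finType) (p : T -> R) (f : T -> A) :
  entropy p f = - \sum_t p t * log2 (marg p f (f t)).
Proof.
rewrite /entropy; congr (- _).
rewrite (partition_big f xpredT)//=; apply: eq_bigr => a _.
by rewrite {1}/marg mulr_suml; apply: eq_bigr => t /eqP ->.
Qed.

Lemma eq_marg_ker (T A B : finType) (p : T -> R) (f : T -> A) (g : T -> B) t :
  (forall u, (f u == f t) = (g u == g t)) -> marg p f (f t) = marg p g (g t).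
Proof. by move=> fg; apply: eq_bigl => u; rewrite fg. Qed.

(** Entropy sees only the partition into fibres, so variables carrying the same information can be
    exchanged even when their types differ. *)
Lemma eq_entropy_ker (T A B : finType) (p : T -> R) (f : T -> A) (g : T -> B) :
  (forall t u, (f t == f u) = (g t == g u)) -> entropy p f = entropy p g.
Proof.
move=> fg; rewrite !entropyE; congr (- _); apply: eq_bigr => t _.
by rewrite (@eq_marg_ker _ _ _ p f g).
Qed.

(** Termwise this is [ln u <= u - 1] at [u = q a / p a]. Letting [q] have less mass than [p] serves
    [fano]. *)
Lemma gibbs (A : finType) (p q : A -> R) :
  (forall a, 0 <= p a) -> (forall a, 0 <= q a) ->
  (forall a, 0 < p a -> 0 < q a) -> \sum_a q a <= \sum_a p a ->
  0 <= \sum_a p a * (log2 (p a) - log2 (q a)).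
Proof.
move=> p0 q0 pq qp; rewrite -oppr_le0 -sumrN.
suff : \sum_a - (p a * (log2 (p a) - log2 (q a))) <=
       \sum_a (q a - p a) / ln 2.
  move=> /le_trans; apply; rewrite -mulr_suml pmulr_lle0 ?invr_gt0 ?ln2_gt0//.
  by rewrite sumrB subr_le0.
apply: ler_sum => a _.
have := p0 a; rewrite le_eqVlt => /predU1P[<-|pa0].
  by rewrite mul0r oppr0 addr0 divr_ge0// ltW// ln2_gt0.
have qa0 := pq _ pa0.
rewrite /log2 -mulrBl mulrA -mulNr ler_pM2r ?invr_gt0 ?ln2_gt0//.
rewrite -mulrN opprB -ln_div ?posrE//.
have := @le_ln1Dx R (q a / p a - 1).
rewrite subrKC ltrBDl subrr divr_gt0// => /(_ isT) h.
have -> : q a - p a = p a * (q a / p a - 1).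
  by rewrite mulrBr mulr1 mulrCA mulfV ?mulr1// gt_eqF.
by rewrite ler_pM2l.
Qed.

End Entropy.

(** * Reduction of the auxiliary alphabet *)

Section Caratheodory.
Context {R : realType} {Z : finType} (g : (Z -> R) -> R).
Hypothesis g_homo : forall (t : R) (nu : Z -> R), 0 <= t -> (forall z, 0 <= nu z) ->
  g (fun z => t * nu z) = t * g nu.

Lemma linear_dependence m (mu : 'I_m -> Z -> R) : (#|Z| < m)%N ->
  exists2 c : 'I_m -> R, (exists v, c v != 0) &
    forall z, \sum_v c v * mu v z = 0.
Proof.
move=> Zm; pose A := \matrix_(v < m, j < #|Z|) mu v (enum_val j).
have /rowV0Pn[c /sub_kermxP cA c0] : kermx A != 0.
  by rewrite kermx_eq0 /row_free ltn_eqF// (leq_ltn_trans (rank_leq_col A)).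
exists (c 0).
  apply/existsP; rewrite -[X in is_true X]negbK negb_exists.
  apply: contra c0 => /forallP c0; apply/eqP/rowP => v; rewrite mxE.
  by apply/eqP; have := c0 v; rewrite negbK.
move=> z; have /matrixP/(_ 0 (enum_rank z)) := cA.
rewrite !mxE => e; rewrite -[RHS]e; apply: eq_bigr => v _.
by rewrite mxE enum_rankK.
Qed.

(** Moving the weights away from 1 along a linear dependence keeps the total measure. The direction
    is one in which the weighted sum of [g] does not decrease, and the motion stops when a weight
    first vanishes. *)
Lemma reweight m (mu : 'I_m -> Z -> R) : (#|Z| < m)%N ->
  (forall v z, 0 <= mu v z) ->
  exists a : 'I_m -> R, [/\ forall v, 0 <= a v, exists v, a v = 0,
    forall z, \sum_v a v * mu v z = \sum_v mu v z &
    \sum_v g (mu v) <= \sum_v a v * g (mu v)].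
Proof.
move=> Zm mu0; have [c [v cv0] cmu] := linear_dependence mu Zm.
wlog cg : c cv0 cmu / 0 <= \sum_v c v * g (mu v).
  move=> h; have [|/ltW cg] := leP 0 (\sum_v c v * g (mu v)); first exact: h.
  apply: (h (fun v => - c v)); first by rewrite oppr_eq0.
  - by move=> z; under eq_bigr do rewrite mulNr; rewrite sumrN cmu oppr0.
  - by under eq_bigr do rewrite mulNr; rewrite sumrN oppr_ge0.
have [[u cu]|cge0] := pselect (exists u, c u < 0).
  case: (@arg_minP _ _ _ u xpredT c isT) => w _ cw.
  have cw0 : c w < 0 by apply: le_lt_trans cu; exact: cw.
  have t0 : 0 < (- c w)^-1 by rewrite invr_gt0 oppr_gt0.
  (* The minimality of [c w] fixes the step length: the weight at [w] vanishes while the others stay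
     non-negative. *)
  exists (fun v => 1 + (- c w)^-1 * c v); split.
  - move=> i; rewrite -(@ler_pM2l _ (- c w)) ?oppr_gt0// mulr0 mulrDr mulr1.
    by rewrite mulVKf ?lt0r_neq0 ?oppr_gt0// addrC subr_ge0 cw.
  - by exists w; rewrite invrN mulNr mulVf ?lt_eqF// subrr.
  - move=> z; under eq_bigr do rewrite mulrDl mul1r -mulrA.
    by rewrite big_split/= -mulr_sumr cmu mulr0 addr0.
  - under [leRHS]eq_bigr do rewrite mulrDl mul1r -mulrA.
    by rewrite big_split/= -mulr_sumr lerDl mulr_ge0// ltW.
have {}cge0 u : 0 <= c u by rewrite leNgt; apply/negP => cu; apply: cge0; exists u.
(* Without a negative coefficient the dependence forces row [v] to vanish, and it can be deleted at
   no cost. *)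
have mu_v z : mu v z = 0.
  have /psumr_eq0P := cmu z => /(_ (fun i _ => mulr_ge0 (cge0 i) (mu0 i z)) v isT).
  by move=> /eqP; rewrite mulf_eq0 (negbTE cv0)/= => /eqP.
have gv : g (mu v) = 0.
  have := g_homo (lexx 0) (mu0 v); rewrite mul0r => <-; congr g.
  by apply/funext => z; rewrite mu_v mulr0.
exists (fun i => (i != v)%:R); split => //.
- by exists v; rewrite eqxx.
- by move=> z; apply: eq_bigr => i _; case: eqVneq => [->|_]; rewrite ?mu_v ?mul1r ?mulr0.
- apply: ler_sum => i _; case: eqVneq => [->|_]; by rewrite ?gv ?mul1r ?mulr0.
Qed.

Lemma drop_row m (mu : 'I_m.+1 -> Z -> R) : (#|Z| < m.+1)%N ->
  (forall v z, 0 <= mu v z) ->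
  exists mu' : 'I_m -> Z -> R, [/\ forall v z, 0 <= mu' v z,
    forall z, \sum_v mu' v z = \sum_v mu v z &
    \sum_v g (mu v) <= \sum_v g (mu' v)].
Proof.
move=> Zm mu0; have [a [a0 [w aw] amu ag]] := reweight Zm mu0.
exists (fun j z => a (lift w j) * mu (lift w j) z); split.
- by move=> v z; rewrite mulr_ge0.
- by move=> z; rewrite -amu (bigD1_ord w)//= aw mul0r add0r.
- apply: le_trans ag _; rewrite (bigD1_ord w)//= aw mul0r add0r.
  by apply: ler_sum => j _; rewrite g_homo.
Qed.

Lemma caratheodory d m (mu : 'I_m -> Z -> R) : (#|Z| <= d)%N ->
  (forall v z, 0 <= mu v z) ->
  exists mu' : 'I_d -> Z -> R, [/\ forall v z, 0 <= mu' v z,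
    forall z, \sum_v mu' v z = \sum_v mu v z &
    \sum_v g (mu v) <= \sum_v g (mu' v)].
Proof.
move=> Zd; elim: m mu => [|m IH] mu mu0.
  exists (fun _ _ => 0); split => //; first by move=> z; rewrite big_ord0 big1.
  rewrite big_ord0 big1// => i _.
  by have := @g_homo 0 (fun=> 0) (lexx _) (fun=> lexx _); rewrite !mul0r.
have [dm|md] := ltnP d m.+1.
  have [mu1 [mu10 mu1E mu1g]] := drop_row (leq_ltn_trans Zd dm) mu0.
  have [mu2 [mu20 mu2E mu2g]] := IH _ mu10.
  exists mu2; split => //; first by move=> z; rewrite mu2E.
  exact: le_trans mu2g.
(* At most [d] rows are left: fill up with zero rows, on which [g] vanishes. *)
rewrite -(subnKC md).
exists (fun i => match fintype.split i with inl j => mu j | inr _ => fun=> 0 end).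
have lE i : fintype.split (lshift (d - m.+1) i) = inl i by exact: (unsplitK (inl i)).
have rE i : fintype.split (rshift m.+1 i) = inr i :> 'I__ + 'I_(d - m.+1).
  exact: (unsplitK (inr i)).
split.
- by move=> i z; case: fintype.split.
- move=> z; rewrite big_split_ord/= [X in _ + X]big1 ?addr0.
    by apply: eq_bigr => i _; rewrite lE.
  by move=> i _; rewrite rE.
- rewrite big_split_ord/= [X in _ + X]big1 ?addr0.
    by apply: ler_sum => i _; rewrite lE.
  move=> i _; rewrite rE.
  by have := @g_homo 0 (fun=> 0) (lexx _) (fun=> lexx _); rewrite !mul0r.
Qed.

End Caratheodory.

(** * The maximal gain *)

Lemma continuous_sum (R : realType) (T : topologicalType) (I : finType)
    (P : pred I) (F : I -> T -> R) :
  (forall i, continuous (F i)) -> continuous (fun x => \sum_(i | P i) F i x).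
Proof.
by move=> Fc; apply: continuous_big => [|i _]; [exact: add_continuous|exact: Fc].
Qed.

Section Gain.
Context {R : realType} {S Z Y : finType}.
Variables (st : Z -> S) (K : Z -> Y -> R) (PS : S -> R).

(* [H(S) - H(Y)] for the law [nu] of the channel input and state; it is
   1-homogeneous, so conditional entropies given an auxiliary variable are
   sums of its values at unnormalized conditional laws. *)
Definition excess (nu : Z -> R) : R :=
  \sum_s nxlogx (\sum_(z | st z == s) nu z) - \sum_y nxlogx (\sum_z nu z * K z y).

(* [I(V;Y) - I(V;S) + H(S)] when [mu v z = P(V = v, Z = z)]. *)
Definition gain {V : finType} (mu : V -> Z -> R) : R :=
  \sum_y nxlogx (\sum_z (\sum_v mu v z) * K z y) + \sum_v excess (mu v).

Definition feasible {V : finType} (mu : V -> Z -> R) : Prop :=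
  (forall v z, 0 <= mu v z) /\
  (forall s, \sum_(z | st z == s) \sum_v mu v z = PS s).

Hypothesis K_pmf : forall z, is_pmf (K z).

(** Scaling adds the same term, total mass times [nxlogx t], to the state sum and to the output sum,
    because [K] preserves mass; the two cancel. *)
Lemma excess_homo (t : R) (nu : Z -> R) : 0 <= t -> (forall z, 0 <= nu z) ->
  excess (fun z => t * nu z) = t * excess nu.
Proof.
move=> t0 nu0; rewrite /excess mulrBr.
have -> : \sum_s nxlogx (\sum_(z | st z == s) t * nu z) =
    t * \sum_s nxlogx (\sum_(z | st z == s) nu z) + (\sum_z nu z) * nxlogx t.
  rewrite [X in X * nxlogx t](partition_big st xpredT)//= mulr_sumr mulr_suml -big_split/=.
  by apply: eq_bigr => s _; rewrite -mulr_sumr nxlogxM// sumr_ge0.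
have -> : \sum_y nxlogx (\sum_z t * nu z * K z y) =
    t * \sum_y nxlogx (\sum_z nu z * K z y) + (\sum_z nu z) * nxlogx t.
  have -> : \sum_z nu z = \sum_y \sum_z nu z * K z y.
    rewrite exchange_big/=; apply: eq_bigr => z _.
    by rewrite -mulr_sumr (K_pmf z).2 mulr1.
  rewrite mulr_sumr mulr_suml -big_split/=; apply: eq_bigr => y _.
  under eq_bigr do rewrite -mulrA.
  by rewrite -mulr_sumr nxlogxM// sumr_ge0// => z _; rewrite mulr_ge0// (K_pmf z).1.
by ring.
Qed.

(** The output term of [gain] depends only on [\sum_v mu v], which [caratheodory] keeps; the rest is
    a sum of the homogeneous [excess], which it does not lower. The bound [d] is thus independent of
    the block length. *)
Lemma gain_le_bounded_card (V : finType) (mu : V -> Z -> R) d :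
  (#|Z| <= d)%N -> feasible mu ->
  exists2 mu' : 'I_d -> Z -> R, feasible mu' & gain mu <= gain mu'.
Proof.
move=> Zd [mu0 muS].
have [mu' [mu'0 mu'E mu'g]] := caratheodory excess_homo
  (mu := fun i : 'I_#|V| => mu (enum_val i)) Zd (fun i => mu0 _).
have sumE (F : V -> R) : \sum_(i < #|V|) F (enum_val i) = \sum_v F v.
  by rewrite [RHS](reindex (fun i : 'I_#|V| => enum_val i))//; exact: onW_bij (enum_val_bij V).
have mu'E' z : \sum_v mu' v z = \sum_v mu v z.
  by rewrite mu'E (sumE (fun v => mu v z)).
exists mu'.
  by split=> // s; rewrite -muS; apply: eq_bigr => z _.
rewrite /gain; under [in leRHS]eq_bigr do under eq_bigr do rewrite mu'E'.
by rewrite lerD2l -(sumE (fun v => excess (mu v))).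
Qed.

Lemma continuous_gain (T : topologicalType) (V : finType) (mu : T -> V -> Z -> R) :
  (forall v z, continuous (fun x => mu x v z)) ->
  continuous (fun x => gain (mu x)).
Proof.
move=> muc.
have nxlogxc (F : T -> R) : continuous F -> continuous (fun x => nxlogx (F x)).
  by move=> Fc x; apply: continuous_comp; [exact: Fc|exact: continuous_nxlogx].
have mulc (F : T -> R) c : continuous F -> continuous (fun x => F x * c).
  by move=> Fc x; apply: cvgM; [exact: Fc|exact: cvg_cst].
have subc (F G : T -> R) : continuous F -> continuous G ->
    continuous (fun x => F x - G x).
  by move=> Fc Gc x; apply: cvgB; [exact: Fc|exact: Gc].
have addc (F G : T -> R) : continuous F -> continuous G ->
    continuous (fun x => F x + G x).
  by move=> Fc Gc x; apply: cvgD; [exact: Fc|exact: Gc].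
apply: addc; apply: continuous_sum.
  move=> y; apply: nxlogxc; apply: continuous_sum => z; apply: mulc.
  by apply: continuous_sum => v; exact: muc.
move=> v; apply: subc; apply: continuous_sum.
  by move=> s; apply: nxlogxc; apply: continuous_sum => z; exact: muc.
move=> y; apply: nxlogxc; apply: continuous_sum => z; apply: mulc; exact: muc.
Qed.

Hypothesis PS_pmf : is_pmf PS.

(** Seen in the product space over ['I_d * Z], the feasible set is a cube cut by closed marginal
    conditions, hence compact. *)
Lemma gain_attains_max d (mu0 : 'I_d -> Z -> R) : feasible mu0 ->
  exists2 mu : 'I_d -> Z -> R, feasible mu &
    forall mu' : 'I_d -> Z -> R, feasible mu' -> gain mu' <= gain mu.
Proof.
move=> fmu0.
pose T := prod_topology (fun _ : 'I_d * Z => R).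
have projc i : continuous (fun f : T => f i).
  exact: (@proj_continuous _ (fun=> R) i).
pose A : set T := [set f | forall i, `[0, 1]%classic (f i)].
have cA : compact A 
  by apply: (@tychonoff _ (fun=> R) (fun=> `[0, 1]%classic)) => i; exact: segment_compact.
pose B s : set T := [set f | \sum_(z | st z == s) \sum_v f (v, z) = PS s].
have cB : closed (\bigcap_s B s).
  apply: closed_bigI => s _.
  apply: (@preimage_closed _ _ (fun f : T => \sum_(z | st z == s) \sum_v f (v, z)) [set PS s]).
    move=> f _; apply: continuous_sum => z; apply: continuous_sum => v.
    exact: projc.
  exact: closed_eq.
have gainc : continuous (fun f : T => gain (fun v z => f (v, z))).
  by apply: continuous_gain => v z; exact: projc.
have feasP (mu : 'I_d -> Z -> R) : feasible mu ->
    (A `&` \bigcap_s B s) (fun i => mu i.1 i.2).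
  move=> [m0 mS]; split; last by move=> s _; exact: mS.
  (* An entry is one term of [PS (st z)], itself one term of a sum equal to 1. *)
  move=> [v z]; rewrite /= in_itv/= m0/= -(PS_pmf).2 (bigD1 (st z))//= -mS.
  rewrite (bigD1 z)//= (bigD1 v)//= -!addrA lerDl !addr_ge0// ?sumr_ge0// => *.
  - by rewrite sumr_ge0.
  - exact: PS_pmf.1.
have [|||f] := @compact_EVT_max T R (fun f : T => gain (fun v z => f (v, z)))
    (A `&` \bigcap_s B s).
- by exists (fun i => mu0 i.1 i.2); exact: feasP.
- exact: compact_closedI.
- exact: continuous_subspaceT.
rewrite inE => -[Af Bf] fmax; exists (fun v z => f (v, z)).
  split; last by move=> s; exact: Bf.
  by move=> v z; have := Af (v, z); rewrite /= in_itv/= => /andP[].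
by move=> mu' fmu'; apply: (fmax (fun i => mu' i.1 i.2)); rewrite inE; exact: feasP.
Qed.

End Gain.

(** * Marginals *)

Section Marginals.
Context {R : realType} {T : finType}.
Implicit Types p : T -> R.

Lemma marg_ge0 (A : finType) p (f : T -> A) a :
  (forall t, 0 <= p t) -> 0 <= marg p f a.
Proof. by move=> p0; rewrite sumr_ge0. Qed.

Lemma sum_marg (A : finType) p (f : T -> A) : \sum_a marg p f a = \sum_t p t.
Proof. by rewrite [RHS](partition_big f xpredT). Qed.

Lemma marg_pair (A B : finType) p (f : T -> A) (g : T -> B) b :
  marg p g b = \sum_a marg p (fun t => (f t, g t)) (a, b).
Proof.
rewrite /marg (partition_big f xpredT)//=; apply: eq_bigr => a _.
by apply: eq_bigl => t; rewrite xpair_eqE andbC.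
Qed.

Lemma entropy_reindex (U A : finType) p (f : T -> A) (h : U -> T) :
  bijective h -> entropy p f = entropy (p \o h) (f \o h).
Proof.
move=> bh; rewrite !entropyE; congr (- _).
rewrite (reindex h)/=; last exact: onW_bij.
apply: eq_bigr => u _; congr (_ * log2 _).
by rewrite /marg (reindex h)//=; exact: onW_bij.
Qed.

End Marginals.

(** * The gain in terms of entropies *)

Section Gain_entropy.
Context {R : realType} {S Z Y : finType}.
Variables (st : Z -> S) (K : Z -> Y -> R).
Hypothesis K_pmf : forall z, is_pmf (K z).

(** The hypothesis makes the output depend on [V] only through [Z], so the [excess] terms add up to
    [H(V, S) - H(V, Y)]. *)
Lemma gain_entropy (T V : finType) (p : T -> R) (mu : V -> Z -> R)
    (fv : T -> V) (fz : T -> Z) (fy : T -> Y) :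
  (forall v z y, marg p (fun t => (fv t, fz t, fy t)) (v, z, y) = mu v z * K z y) ->
  gain st K mu = entropy p fy - entropy p (fun t => (fv t, fy t))
                 + entropy p (fun t => (fv t, st (fz t))).
Proof.
move=> pE; rewrite /gain /excess !entropy_nxlogx.
rewrite sumrB addrA addrAC; congr (_ - _ + _).
- apply: eq_bigr => y _; congr nxlogx.
  rewrite (marg_pair p (fun t => (fv t, fz t))).
  rewrite -(pair_bigA _ (fun v z => marg p (fun t => (fv t, fz t, fy t)) (v, z, y)))/=.
  rewrite exchange_big/=; apply: eq_bigr => z _.
  by rewrite mulr_suml; apply: eq_bigr => v _; rewrite pE.
- rewrite pair_bigA/=; apply: eq_bigr => -[v y] _ /=; congr nxlogx.
  rewrite (marg_pair p fz); apply: eq_bigr => z _; rewrite -pE.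
  by apply: eq_bigl => t; rewrite !xpair_eqE andbCA andbA.
- rewrite pair_bigA/=; apply: eq_bigr => -[v s] _ /=; congr nxlogx.
  rewrite (marg_pair p fz) big_mkcond/=; apply: eq_bigr => z _.
  case: ifPn => [/eqP <-|zs]; last first.
    rewrite /marg big_pred0// => t; apply/negbTE; apply: contra zs.
    by rewrite !xpair_eqE => /and3P[/eqP <- _].
  rewrite -[mu v z]mulr1 -(K_pmf z).2 mulr_sumr.
  rewrite (marg_pair p fy); apply: eq_bigr => y _; rewrite -pE.
  apply: eq_bigl => t; rewrite !xpair_eqE.
  case: (fz t =P z) => [->|]; rewrite ?eqxx ?andbT ?andbF//=.
  by rewrite andbC.
Qed.

End Gain_entropy.

(** * Adjoining an independent uniform variable *)

Section Uniform_factor.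
Context {R : realType} {V T : finType} (p : V * T -> R) (q : T -> R).
Hypothesis pE : forall v t, p (v, t) = #|V|%:R^-1 * q t.
Hypothesis q_pmf : is_pmf q.
Hypothesis V0 : (0 < #|V|)%N.

Let cV : #|V|%:R * #|V|%:R^-1 = 1 :> R.
Proof. by rewrite mulfV// pnatr_eq0 -lt0n. Qed.

Lemma marg_uniform_factor (A : finType) (f : T -> A) v a :
  marg p (fun u => (f u.2, u.1)) (a, v) = #|V|%:R^-1 * marg q f a.
Proof.
rewrite /marg mulr_sumr.
transitivity (\sum_(w | w == v) \sum_(t | f t == a) p (w, t)).
  rewrite pair_big/=; apply: eq_big => [[w t]|[w t] _]//=.
  by rewrite xpair_eqE andbC.
by rewrite big_pred1_eq; apply: eq_bigr => t _; rewrite pE.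
Qed.

Lemma entropy_uniform_factor (A : finType) (f : T -> A) :
  entropy p (fun u => (f u.2, u.1)) = entropy q f + log2 #|V|%:R.
Proof.
rewrite !entropy_nxlogx.
rewrite -(pair_bigA _ (fun a v => nxlogx (marg p (fun u => (f u.2, u.1)) (a, v))))/=.
under eq_bigr do under eq_bigr do rewrite marg_uniform_factor.
have -> : log2 #|V|%:R = (\sum_a marg q f a) * log2 #|V|%:R :> R.
  by rewrite sum_marg q_pmf.2 mul1r.
rewrite mulr_suml -big_split/=; apply: eq_bigr => a _.
rewrite sumr_const -[X in X = _]mulr_natl nxlogxM ?invr_ge0//; last exact: marg_ge0 q_pmf.1.
rewrite mulrDr mulrA cV mul1r; congr (_ + _).
rewrite mulrCA; congr (_ * _).
by rewrite /nxlogx log2V ?ltr0n// !mulrN opprK mulrA cV mul1r.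
Qed.

Lemma entropy_uniform_factor_snd (A : finType) (f : T -> A) :
  entropy p (fun u => f u.2) = entropy q f.
Proof.
rewrite !entropy_nxlogx; apply: eq_bigr => a _; congr nxlogx.
transitivity (\sum_(t | f t == a) \sum_v p (v, t)).
  by rewrite exchange_big pair_big/=; apply: eq_bigr => -[].
apply: eq_bigr => t _.
by under eq_bigr do rewrite pE; rewrite sumr_const -[LHS]mulr_natl mulrA cV mul1r.
Qed.

End Uniform_factor.

(** * One-time pad *)

Lemma sum_pair (R : realType) (A B : finType) (F : A * B -> R) :
  \sum_u F u = \sum_a \sum_b F (a, b).
Proof. by rewrite pair_bigA; apply: eq_bigr => -[]. Qed.

Section Outer_region.
Context {R : realType} {X1 X2 S Y : finType}.
Variables (PS : S -> R) (W : X1 -> X2 -> S -> Y -> R).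
Hypotheses (PS_pmf : is_pmf PS) (W_channel : is_channel W).

Local Notation Z := (S * X1 * X2)%type.
Definition state_of (z : Z) : S := z.1.1.
Definition chan_of (z : Z) : Y -> R := W z.1.2 z.2 z.1.1.

Lemma chan_of_pmf z : is_pmf (chan_of z).
Proof. exact: W_channel. Qed.

Lemma sum_state_of (F : Z -> R) s :
  \sum_(z | state_of z == s) F z = \sum_x1 \sum_x2 F (s, x1, x2).
Proof.
rewrite big_mkcond/= !sum_pair (bigD1 s)//= [X in _ + X]big1 ?addr0.
  by apply: eq_bigr => x1 _; apply: eq_bigr => x2 _; rewrite /state_of eqxx.
move=> s' s's; rewrite big1// => x1 _; rewrite big1// => x2 _.
by rewrite /state_of/= (negbTE s's).
Qed.

Section One_time_pad.
Variables (d : nat) (mu : 'I_d.+1 -> Z -> R).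
Hypothesis mu_feas : feasible state_of PS mu.
Local Notation V := 'I_d.+1.
Local Notation D := (#|V|%:R : R).

Let D_gt0 : 0 < D.
Proof. by rewrite card_ord ltr0n. Qed.

(** Joint mass of [(V + U, U, Z)] for a uniform [U] independent of [(V, Z)]; the subtraction is that
    of the cyclic group ['I_d.+1]. *)
Definition pad (v1 v2 : V) (z : Z) : R := D^-1 * mu (v1 - v2) z.

(** At a state of probability zero any law would do; the marginal of [pad] over all states is one
    that needs no choice of a point in the alphabets. *)
Definition pad_kernel (s : S) (t : (V * V * X1 * X2)%type) : R :=
  let '(v1, v2, x1, x2) := t in
  if PS s == 0 then \sum_s' pad v1 v2 (s', x1, x2)
  else pad v1 v2 (s, x1, x2) / PS s.

Lemma pad_ge0 v1 v2 z : 0 <= pad v1 v2 z.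
Proof. by rewrite mulr_ge0 ?invr_ge0 ?(ltW D_gt0)//; exact: mu_feas.1. Qed.

Lemma sum_pad z : \sum_v1 \sum_v2 pad v1 v2 z = \sum_v mu v z.
Proof.
rewrite exchange_big/=.
under eq_bigr => v2 _.
  rewrite (reindex_inj (addIr v2))/=.
  under eq_bigr do rewrite /pad addrK.
  rewrite -mulr_sumr.
  over.
by rewrite sumr_const -[LHS]mulr_natl mulrA mulfV ?mul1r// gt_eqF.
Qed.

Lemma sum_pad_state s :
  \sum_v1 \sum_v2 \sum_x1 \sum_x2 pad v1 v2 (s, x1, x2) = PS s.
Proof.
rewrite -mu_feas.2 sum_state_of.
under eq_bigr do rewrite exchange_big.
rewrite exchange_big; apply: eq_bigr => x1 _ /=.
under eq_bigr do rewrite exchange_big.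
rewrite exchange_big; apply: eq_bigr => x2 _ /=.
exact: sum_pad.
Qed.

Lemma pad_kernel_pmf s : is_pmf (pad_kernel s).
Proof.
split.
  move=> [[[v1 v2] x1] x2]; rewrite /pad_kernel; case: ifP => _.
    by rewrite sumr_ge0// => *; exact: pad_ge0.
  by rewrite divr_ge0 ?pad_ge0//; exact: PS_pmf.1.
rewrite !sum_pair /pad_kernel; case: eqP => [_|/eqP s0]; last first.
  under eq_bigr do under eq_bigr do under eq_bigr do rewrite -mulr_suml.
  under eq_bigr do under eq_bigr do rewrite -mulr_suml.
  under eq_bigr do rewrite -mulr_suml.
  by rewrite -mulr_suml sum_pad_state mulfV.
rewrite -PS_pmf.2; under [RHS]eq_bigr do rewrite -sum_pad_state.
rewrite [RHS]exchange_big; apply: eq_bigr => v1 _ /=.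
rewrite [RHS]exchange_big; apply: eq_bigr => v2 _ /=.
rewrite [RHS]exchange_big; apply: eq_bigr => x1 _ /=.
by rewrite [RHS]exchange_big.
Qed.

(** Where [PS s] vanishes, feasibility forces every [mu v] to vanish at [s], so the default law is
    harmless. *)
Lemma pad_kernelE s v1 v2 x1 x2 :
  PS s * pad_kernel s (v1, v2, x1, x2) = pad v1 v2 (s, x1, x2).
Proof.
rewrite /pad_kernel; case: eqP => [s0|/eqP s0]; last by rewrite mulrC divfK.
rewrite s0 mul0r; apply/esym.
suff m0 : mu (v1 - v2) (s, x1, x2) = 0 by rewrite /pad m0 mulr0.
have mu0 := mu_feas.1.
have := mu_feas.2 s; rewrite s0.
move=> /psumr_eq0P/(_ (s, x1, x2)); rewrite /state_of eqxx => h.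
have /psumr_eq0P : \sum_v mu v (s, x1, x2) = 0.
  by apply: h => // z _; rewrite sumr_ge0.
by apply.
Qed.

Let q (w : (V * Z * Y)%type) : R := mu w.1.1 w.1.2 * chan_of w.1.2 w.2.

Let q_pmf : is_pmf q.
Proof.
split; first by move=> w; rewrite mulr_ge0 ?mu_feas.1//; exact: (chan_of_pmf _).1.
rewrite sum_pair sum_pair -PS_pmf.2 (eq_bigr (fun v => \sum_z mu v z)); last first.
  by move=> v _; apply: eq_bigr => z _; rewrite /q /= -mulr_sumr (chan_of_pmf _).2 mulr1.
rewrite exchange_big (partition_big state_of xpredT)//=.
by apply: eq_bigr => s _; exact: mu_feas.2.
Qed.

Let q_gain : gain state_of chan_of mu - \sum_s nxlogx (PS s) =
  entropy q (fun w => w.2) - entropy q (fun w => (w.1.1, w.2))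
  + entropy q (fun w => (w.1.1, state_of w.1.2))
  - entropy q (fun w => state_of w.1.2).
Proof.
have qE v z y : marg q (fun w => (w.1.1, w.1.2, w.2)) (v, z, y) = mu v z * chan_of z y.
  by rewrite /marg (big_pred1 (v, z, y))// => -[[v' z'] y'].
rewrite (gain_entropy state_of chan_of_pmf qE).
congr (_ - _); rewrite entropy_nxlogx; apply: eq_bigr => s _; congr nxlogx.
rewrite -mu_feas.2 /marg [LHS]big_mkcond [RHS]big_mkcond/=.
rewrite [RHS]sum_pair [RHS]sum_pair [RHS]exchange_big/=.
apply: eq_bigr => z _; case: ifP => _; last by rewrite big1// => v _; rewrite big1.
by apply: eq_bigr => v _; rewrite /q /= -mulr_sumr (chan_of_pmf _).2 mulr1.
Qed.

(** All three bounds equal the same number: given either share, the other one reveals [V], and each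
    entropy is that of an unpadded variable plus [log2 D] or 0; these surpluses cancel. *)
Lemma one_time_pad r1 r2 :
  r1 <= gain state_of chan_of mu - \sum_s nxlogx (PS s) ->
  r2 <= gain state_of chan_of mu - \sum_s nxlogx (PS s) ->
  r1 + r2 <= gain state_of chan_of mu - \sum_s nxlogx (PS s) ->
  outer_region PS W (r1, r2).
Proof.
rewrite q_gain => h1 h2 h12.
exists 'I_d.+1, 'I_d.+1, pad_kernel; split; first exact: pad_kernel_pmf.
move=> p rS rV1 rV2 rY rV12.
(* Two parametrizations of one law: [j1] takes [V2] as the independent uniform key, [j2] takes [V1]
   and recovers [V2] as [V1 - V]. *)
pose j1 (u : (V * (V * Z * Y))%type) :=
  let: (v2, (v, (s, x1, x2), y)) := u in (s, v + v2, v2, x1, x2, y).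
pose j2 (u : (V * (V * Z * Y))%type) :=
  let: (v1, (v, (s, x1, x2), y)) := u in (s, v1, v1 - v, x1, x2, y).
have bj1 : bijective j1.
  exists (fun t : (S * V * V * X1 * X2 * Y)%type =>
    let: (s, v1, v2, x1, x2, y) := t in (v2, (v1 - v2, (s, x1, x2), y))).
    by move=> [v2 [[v [[s x1] x2]] y]] /=; rewrite addrK.
  by move=> [[[[[s v1] v2] x1] x2] y] /=; rewrite subrK.
have bj2 : bijective j2.
  exists (fun t : (S * V * V * X1 * X2 * Y)%type =>
    let: (s, v1, v2, x1, x2, y) := t in (v1, (v1 - v2, (s, x1, x2), y))).
    by move=> [v2 [[v [[s x1] x2]] y]] /=; rewrite subKr.
  by move=> [[[[[s v1] v2] x1] x2] y] /=; rewrite subKr.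
have pj1 v w : (p \o j1) (v, w) = D^-1 * q w.
  case: w => [[w [[s x1] x2]] y].
  by rewrite /p /= pad_kernelE /pad addrK mulrA.
have pj2 v w : (p \o j2) (v, w) = D^-1 * q w.
  case: w => [[w [[s x1] x2]] y].
  by rewrite /p /= pad_kernelE /pad subKr mulrA.
have cV : (0 < #|V|)%N by rewrite card_ord.
(* [E1] and [E2] serve variables that determine [V2], respectively [V1]; [E0] serves those that
   involve neither. *)
have E1 (A B : finType) (f : _ -> A) (g : (V * Z * Y)%type -> B) :
    (forall u u', (f (j1 u) == f (j1 u')) = ((g u.2, u.1) == (g u'.2, u'.1))) ->
    entropy p f = entropy q g + log2 D.
  move=> fg; rewrite -(entropy_uniform_factor pj1 q_pmf cV) (entropy_reindex _ _ bj1).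
  exact: eq_entropy_ker.
have E2 (A B : finType) (f : _ -> A) (g : (V * Z * Y)%type -> B) :
    (forall u u', (f (j2 u) == f (j2 u')) = ((g u.2, u.1) == (g u'.2, u'.1))) ->
    entropy p f = entropy q g + log2 D.
  move=> fg; rewrite -(entropy_uniform_factor pj2 q_pmf cV) (entropy_reindex _ _ bj2).
  exact: eq_entropy_ker.
have E0 (A B : finType) (f : _ -> A) (g : (V * Z * Y)%type -> B) :
    (forall u u', (f (j1 u) == f (j1 u')) = (g u.2 == g u'.2)) ->
    entropy p f = entropy q g.
  move=> fg; rewrite -(entropy_uniform_factor_snd pj1 cV) (entropy_reindex _ _ bj1).
  exact: eq_entropy_ker.
have YV2 : entropy p (fun t => (rY t, rV2 t)) = entropy q (fun w => w.2) + log2 D.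
  by apply: (@E1 _ _ _ (fun w => w.2)) =>
    -[v2 [[v [[s x1] x2]] y]] [v2' [[v' [[s' x1'] x2']] y']].
have SV2 : entropy p (fun t => (rS t, rV2 t)) = entropy q (fun w => state_of w.1.2) + log2 D.
  by apply: (@E1 _ _ _ (fun w => state_of w.1.2)) =>
    -[v2 [[v [[s x1] x2]] y]] [v2' [[v' [[s' x1'] x2']] y']].
have YV1 : entropy p (fun t => (rY t, rV1 t)) = entropy q (fun w => w.2) + log2 D.
  by apply: (@E2 _ _ _ (fun w => w.2)) =>
    -[v2 [[v [[s x1] x2]] y]] [v2' [[v' [[s' x1'] x2']] y']].
have SV1 : entropy p (fun t => (rS t, rV1 t)) = entropy q (fun w => state_of w.1.2) + log2 D.
  by apply: (@E2 _ _ _ (fun w => state_of w.1.2)) =>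
    -[v2 [[v [[s x1] x2]] y]] [v2' [[v' [[s' x1'] x2']] y']].
have V1YV2 : entropy p (fun t => (rV1 t, rY t, rV2 t)) = entropy q (fun w => (w.1.1, w.2)) + log2 D.
  apply: (@E1 _ _ _ (fun w => (w.1.1, w.2))) =>
    -[v2 [[v [[s x1] x2]] y]] [v2' [[v' [[s' x1'] x2']] y']].
  rewrite /rV12 /rV1 /rV2 /rY /rS /state_of /j1 /j2 !xpair_eqE.
  by case: (v2 =P v2') => [->|]; rewrite ?andbT ?andbF ?(inj_eq (addIr _)).
have V1SV2 : entropy p (fun t => (rV1 t, rS t, rV2 t)) =
    entropy q (fun w => (w.1.1, state_of w.1.2)) + log2 D.
  apply: (@E1 _ _ _ (fun w => (w.1.1, state_of w.1.2))) =>
    -[v2 [[v [[s x1] x2]] y]] [v2' [[v' [[s' x1'] x2']] y']].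
  rewrite /rV12 /rV1 /rV2 /rY /rS /state_of /j1 /j2 !xpair_eqE.
  by case: (v2 =P v2') => [->|]; rewrite ?andbT ?andbF ?(inj_eq (addIr _)).
have V2YV1 : entropy p (fun t => (rV2 t, rY t, rV1 t)) = entropy q (fun w => (w.1.1, w.2)) + log2 D.
  apply: (@E2 _ _ _ (fun w => (w.1.1, w.2))) =>
    -[v2 [[v [[s x1] x2]] y]] [v2' [[v' [[s' x1'] x2']] y']].
  rewrite /rV12 /rV1 /rV2 /rY /rS /state_of /j1 /j2 !xpair_eqE.
  by case: (v2 =P v2') => [->|]; rewrite ?andbT ?andbF ?(inj_eq (addrI _)) ?eqr_opp.
have V2SV1 : entropy p (fun t => (rV2 t, rS t, rV1 t)) =
    entropy q (fun w => (w.1.1, state_of w.1.2)) + log2 D.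
  apply: (@E2 _ _ _ (fun w => (w.1.1, state_of w.1.2))) =>
    -[v2 [[v [[s x1] x2]] y]] [v2' [[v' [[s' x1'] x2']] y']].
  rewrite /rV12 /rV1 /rV2 /rY /rS /state_of /j1 /j2 !xpair_eqE.
  by case: (v2 =P v2') => [->|]; rewrite ?andbT ?andbF ?(inj_eq (addrI _)) ?eqr_opp.
have Y0 : entropy p (fun t => (rY t, tt)) = entropy q (fun w => w.2).
  apply: (@E0 _ _ _ (fun w => w.2)) =>
    -[v2 [[v [[s x1] x2]] y]] [v2' [[v' [[s' x1'] x2']] y']].
  by rewrite xpair_eqE andbT.
have S0 : entropy p (fun t => (rS t, tt)) = entropy q (fun w => state_of w.1.2).
  apply: (@E0 _ _ _ (fun w => state_of w.1.2)) =>
    -[v2 [[v [[s x1] x2]] y]] [v2' [[v' [[s' x1'] x2']] y']].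
  by rewrite xpair_eqE andbT.
have VY : entropy p (fun t => (rV12 t, rY t, tt)) = entropy q (fun w => (w.1.1, w.2)) + log2 D.
  apply: (@E1 _ _ _ (fun w => (w.1.1, w.2))) =>
    -[v2 [[v [[s x1] x2]] y]] [v2' [[v' [[s' x1'] x2']] y']].
  rewrite /rV12 /rV1 /rV2 /rY /rS /state_of /j1 /j2 !xpair_eqE.
  by case: (v2 =P v2') => [->|]; rewrite ?andbT ?andbF ?(inj_eq (addIr _)).
have VS : entropy p (fun t => (rV12 t, rS t, tt)) =
    entropy q (fun w => (w.1.1, state_of w.1.2)) + log2 D.
  apply: (@E1 _ _ _ (fun w => (w.1.1, state_of w.1.2))) =>
    -[v2 [[v [[s x1] x2]] y]] [v2' [[v' [[s' x1'] x2']] y']].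
  rewrite /rV12 /rV1 /rV2 /rY /rS /state_of /j1 /j2 !xpair_eqE.
  by case: (v2 =P v2') => [->|]; rewrite ?andbT ?andbF ?(inj_eq (addIr _)).
(* The entropies of the shares alone, single or joint, are never computed: they cancel in the
   differences. *)
rewrite /mi /cmi {}YV2 {}SV2 {}YV1 {}SV1 {}V1YV2 {}V1SV2.
rewrite {}V2YV1 {}V2SV1 {}Y0 {}S0 {}VY {}VS /=.
by split; lra.
Qed.

End One_time_pad.
End Outer_region.

(** * Sequences generated by causal kernels *)

Section Causal_kernels.
Context {R : realType} {Y : finType} {n : nat}.
Implicit Types (y : {ffun 'I_n -> Y}) (k : 'I_n) (b : Y).

Definition upd y k b : {ffun 'I_n -> Y} := [ffun j => if j == k then b else y j].

Definition depends_below (A : Type) (m : nat) (h : {ffun 'I_n -> Y} -> A) :=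
  forall y y', (forall j : 'I_n, (j < m)%N -> y j = y' j) -> h y = h y'.

Lemma upd_below (A : Type) (h : {ffun 'I_n -> Y} -> A) m y k b :
  depends_below m h -> (m <= k)%N -> h (upd y k b) = h y.
Proof.
move=> hm mk; apply: hm => j jm; rewrite ffunE ifN//.
by apply: contraTneq jm => ->; rewrite -leqNgt.
Qed.

Hypothesis Y_gt0 : (0 < #|Y|)%N.

(** Exchanging [y k] with the extra symbol is an involution on pairs [(y, b)], so resampling a
    coordinate counts every sequence [#|Y|] times. *)
Lemma sum_resample k (f : {ffun 'I_n -> Y} -> R) :
  \sum_y f y = #|Y|%:R^-1 * \sum_y \sum_b f (upd y k b).
Proof.
pose h (u : {ffun 'I_n -> Y} * Y) := (upd u.1 k u.2, u.1 k).
have hK : involutive h.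
  move=> [y b]; rewrite /h /= !ffunE eqxx; congr pair.
  by apply/ffunP => j; rewrite !ffunE; case: eqVneq => [->|].
rewrite pair_bigA/= (reindex_inj (inv_inj hK))/=.
have -> : \sum_u f (upd (upd u.1 k u.2) k (u.1 k)) = \sum_y \sum_(b : Y) f y.
  by rewrite pair_bigA/=; apply: eq_bigr => u _; have /(congr1 fst)/= -> := hK u.
under [in RHS]eq_bigr => y _ do rewrite sumr_const -[f y *+ _]mulr_natl.
by rewrite -mulr_sumr mulrA mulVf ?mul1r// pnatr_eq0 -lt0n.
Qed.

Variable A : 'I_n -> {ffun 'I_n -> Y} -> R.
Hypothesis A_causal : forall k, depends_below k.+1 (A k).
Hypothesis A_sum1 : forall k y, \sum_b A k (upd y k b) = 1.

(* The kernels of index [>= m] are replaced by the uniform one, which does not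
   change the law of the first [m] coordinates. *)
Let P (m : nat) y : R := \prod_(k < n) (if (k < m)%N then A k y else #|Y|%:R^-1).

Let rest k y : R := \prod_(j < n | j != k) (if (j < k)%N then A j y else #|Y|%:R^-1).

Let rest_upd k y b : rest k (upd y k b) = rest k y.
Proof.
by apply: eq_bigr => j _; case: ifP => // jk; apply: upd_below jk; exact: A_causal.
Qed.

Let P_rest k y : P k y = #|Y|%:R^-1 * rest k y.
Proof. by rewrite /P (bigD1 k)//= ltnn. Qed.

Let PS_rest k y : P k.+1 y = A k y * rest k y.
Proof.
rewrite /P (bigD1 k)//= ltnSn; congr (_ * _); apply: eq_bigr => j jk.
by rewrite ltnS leq_eqVlt -(inj_eq val_inj) in jk *; rewrite (negbTE jk).
Qed.

(** The [#|Y|^-1] of [sum_resample] is exactly the factor of index [k] in [P k], so averaging over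
    coordinate [k] trades [P k.+1] for [P k]. *)
Let sum_P_succ k (h g : {ffun 'I_n -> Y} -> R) : depends_below k h ->
  \sum_y h y * g y * P k.+1 y = \sum_y h y * (\sum_b g (upd y k b) * A k (upd y k b)) * P k y.
Proof.
move=> hk; rewrite (sum_resample k) mulr_sumr; apply: eq_bigr => y _.
rewrite P_rest mulrCA; congr (_ * _).
rewrite mulr_sumr mulr_suml; apply: eq_bigr => b _.
by rewrite PS_rest rest_upd (upd_below y b hk)// !mulrA.
Qed.

(** The kernels are removed from the last one down to index [m]; each sums to 1 over its own
    coordinate, which [h] and the earlier kernels do not see. *)
Let sum_P_ge m (h : {ffun 'I_n -> Y} -> R) : (m <= n)%N -> depends_below m h ->
  \sum_y h y * \prod_k A k y = \sum_y h y * P m y.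
Proof.
move=> mn; rewrite -(subKn mn); elim: (n - m)%N => [|d IH] in h *.
  rewrite subn0 => _; apply: eq_bigr => y _; congr (_ * _).
  by apply: eq_bigr => k _; rewrite ltn_ord.
(* Subtraction is truncated: nothing is left to remove once [d] reaches [n]. *)
have [nd|dn] := leqP n d.
  by have -> : (n - d.+1 = n - d)%N; [lia|exact: IH].
move=> hd; rewrite IH; last by move=> y y' e; apply: hd => j jd; apply: e; lia.
have nd1 : (n - d.+1 < n)%N by lia.
pose k := Ordinal nd1.
have -> : (n - d = k.+1)%N by rewrite /=; lia.
rewrite (eq_bigr (fun y => h y * 1 * P k.+1 y)); last by move=> y _; rewrite mulr1.
rewrite (@sum_P_succ k h (fun=> 1) hd); apply: eq_bigr => y _; congr (_ * _).
by under eq_bigr do rewrite mul1r; rewrite A_sum1 mulr1.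
Qed.

Lemma causal_sum1 : \sum_y \prod_k A k y = 1.
Proof.
rewrite (eq_bigr (fun y => 1 * \prod_k A k y)); last by move=> y _; rewrite mul1r.
rewrite (sum_P_ge (m := 0))//.
under eq_bigr do rewrite mul1r /P prodr_const.
rewrite sumr_const -[LHS]mulr_natl card_ffun !card_ord natrX -exprMn mulfV ?expr1n//.
by rewrite pnatr_eq0 -lt0n.
Qed.

(** This says that [A k] is the conditional law of coordinate [k] given the earlier ones. The left
    side reduces to [P k.+1], the right side to [P k], and [sum_P_succ] links them. *)
Lemma causal_factor k b (h : {ffun 'I_n -> Y} -> R) : depends_below k h ->
  \sum_y h y * (y k == b)%:R * \prod_j A j y =
  \sum_y h y * A k (upd y k b) * \prod_j A j y.
Proof.
move=> hk; rewrite (sum_P_ge (m := k.+1) (h := fun y => h y * (y k == b)%:R))//; last first.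
  by move=> y y' e; rewrite (hk y y') ?e// => j jk; apply: e; exact: ltnW.
rewrite (sum_P_ge (m := k) (h := fun y => h y * A k (upd y k b))) 1?ltnW//; last first.
  move=> y y' e; rewrite (hk y y')//; congr (_ * _); apply: A_causal => j.
  rewrite ltnS leq_eqVlt (inj_eq val_inj) !ffunE.
  by case: eqVneq => [//|_ /= jk]; rewrite e.
rewrite (@sum_P_succ k h (fun y => (y k == b)%:R) hk); apply: eq_bigr => y _.
congr (_ * _ * _); rewrite (bigD1 b)//= [X in _ + X]big1 ?addr0.
  by rewrite ffunE !eqxx mul1r.
by move=> b' bb'; rewrite ffunE eqxx (negbTE bb') mul0r.
Qed.

End Causal_kernels.

(** * Converse for a code *)

Lemma marg_comp (R : realType) (T A B : finType) (p : T -> R) (f : T -> A)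
    (h : A -> B) b :
  marg p (fun t => h (f t)) b = \sum_(a | h a == b) marg p f a.
Proof.
rewrite /marg (partition_big f (fun a => h a == b))//=.
apply: eq_bigr => a /eqP <-; apply: eq_bigl => t.
by case: (f t =P a) => [->|]; rewrite ?eqxx ?andbF.
Qed.

Lemma sum_marg_mul (R : realType) (T A : finType) (p : T -> R) (f : T -> A)
    (F : A -> R) :
  \sum_a marg p f a * F a = \sum_t p t * F (f t).
Proof.
rewrite [RHS](partition_big f xpredT)//=; apply: eq_bigr => a _.
by rewrite mulr_suml; apply: eq_bigr => t /eqP ->.
Qed.

Lemma marg_gt0 (R : realType) (T A : finType) (p : T -> R) (f : T -> A) t :
  (forall u, 0 <= p u) -> 0 < p t -> 0 < marg p f (f t).
Proof.
by move=> p0 pt; rewrite /marg (bigD1 t)//= ltr_wpDr// sumr_ge0.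
Qed.

Lemma sum_prod_pmf (R : realType) (A : finType) n (q : 'I_n -> A -> R) :
  (forall k, \sum_a q k a = 1) ->
  \sum_(s : {ffun 'I_n -> A}) \prod_k q k (s k) = 1.
Proof. by move=> q1; rewrite -bigA_distr_bigA big1. Qed.

Lemma marg_prod_pmf (R : realType) (A : finType) n (q : A -> R) (k : 'I_n) a :
  \sum_a q a = 1 ->
  \sum_(s : {ffun 'I_n -> A} | s k == a) \prod_j q (s j) = q a.
Proof.
move=> q1.
(* The event [s k == a] is a product set constraining coordinate [k] alone, so its mass
   factorizes. *)
have : \prod_(j < n) \sum_(b | (j == k) ==> (b == a)) q b =
    \sum_(s in family (fun (j : 'I_n) b => (j == k) ==> (b == a))) \prod_j q (s j).
  exact: bigA_distr_big_dep.
rewrite (bigD1 k)//= [X in _ * X]big1; last first.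
  by move=> j jk; rewrite (negbTE jk)/=.
rewrite mulr1 eqxx/= big_pred1_eq => ->; apply: eq_bigl => s.
apply/idP/familyP => [/eqP sk j|/(_ k)]; last by rewrite unfold_in eqxx.
by rewrite unfold_in; apply/implyP => /eqP ->; rewrite sk.
Qed.

Section Converse.
Context {R : realType} {X1 X2 S Y : finType}.
Variables (PS : S -> R) (W : X1 -> X2 -> S -> Y -> R).
Hypotheses (PS_pmf : is_pmf PS) (W_channel : is_channel W).
Variables (n M1 M2 : nat) (c : fbcode X1 X2 S Y n M1 M2).
Hypotheses (M1_gt0 : (0 < M1)%N) (M2_gt0 : (0 < M2)%N) (Y_gt0 : (0 < #|Y|)%N).

Local Notation Om := ('I_M1 * 'I_M2 * {ffun 'I_n -> S} * {ffun 'I_n -> Y})%type.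
Local Notation M := ((M1 * M2)%:R : R).

Let M_gt0 : 0 < M. Proof. by rewrite ltr0n muln_gt0 M1_gt0. Qed.

Definition step_prob (w : 'I_M1 * 'I_M2) (s : {ffun 'I_n -> S}) (k : 'I_n)
  (y : {ffun 'I_n -> Y}) : R :=
  W (enc1 c k w.1 s (past y k)) (enc2 c k w.2 s (past y k)) (s k) (y k).

(** The channel inputs are left out, being functions of messages, states and past outputs. *)
Definition code_law (o : Om) : R :=
  M^-1 * (\prod_k PS (o.1.2 k)) * \prod_k step_prob o.1.1 o.1.2 k o.2.

Lemma past_depends (k : 'I_n) : depends_below k (fun y : {ffun 'I_n -> Y} => past y k).
Proof. by move=> y y' e; apply/ffunP => j; rewrite !ffunE; apply: e => /=. Qed.

Lemma past_upd y (k : 'I_n) (b : Y) : past (upd y k b) k = past y k.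
Proof. by apply: (upd_below (h := fun y => past y k)) (leqnn k); exact: past_depends. Qed.

Lemma step_prob_depends w s (k : 'I_n) : depends_below k.+1 (step_prob w s k).
Proof.
move=> y y' e; rewrite /step_prob e// (past_depends (y := y) (y' := y'))//.
by move=> j jk; apply: e; exact: ltnW.
Qed.

Lemma step_prob_upd w s k y b : step_prob w s k (upd y k b) =
  W (enc1 c k w.1 s (past y k)) (enc2 c k w.2 s (past y k)) (s k) b.
Proof. by rewrite /step_prob past_upd ffunE eqxx. Qed.

Lemma step_prob_sum1 w s k y : \sum_b step_prob w s k (upd y k b) = 1.
Proof. by under eq_bigr do rewrite step_prob_upd; exact: (W_channel _ _ _).2. Qed.

Lemma code_law_ge0 o : 0 <= code_law o.
Proof.
rewrite /code_law !mulr_ge0 ?invr_ge0 ?(ltW M_gt0)// prodr_ge0// => k _.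
  exact: PS_pmf.1.
exact: (W_channel _ _ _).1.
Qed.

Lemma sum_output w s : \sum_y code_law (w, s, y) = M^-1 * \prod_k PS (s k).
Proof.
rewrite /code_law /= -mulr_sumr.
by rewrite (causal_sum1 Y_gt0 (@step_prob_depends w s) (@step_prob_sum1 w s)) mulr1.
Qed.

Lemma sum_message : \sum_(w : 'I_M1 * 'I_M2) M^-1 = 1 :> R.
Proof.
by rewrite sumr_const -[LHS]mulr_natl card_prod !card_ord mulfV// gt_eqF.
Qed.

Lemma code_law_pmf : is_pmf code_law.
Proof.
split; first exact: code_law_ge0.
rewrite sum_pair sum_pair -sum_message; apply: eq_bigr => w _.
under eq_bigr do rewrite sum_output.
by rewrite -mulr_sumr (@sum_prod_pmf R S n (fun=> PS)) ?mulr1// => _; exact: PS_pmf.2.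
Qed.

Lemma code_law_err : \sum_o code_law o * (dec c o.2 != o.1.1)%:R = err_prob PS W c.
Proof.
rewrite !sum_pair /err_prob mulr_sumr; apply: eq_bigr => w1 _.
rewrite mulr_sumr; apply: eq_bigr => w2 _.
rewrite mulr_sumr; apply: eq_bigr => s _.
by rewrite !mulr_sumr; apply: eq_bigr => y _; rewrite /code_law/= !mulrA.
Qed.

Lemma marg_state k a : marg code_law (fun o => o.1.2 k) a = PS a.
Proof.
rewrite /marg big_mkcond sum_pair sum_pair.
transitivity (\sum_(w : 'I_M1 * 'I_M2) M^-1 * PS a); last by rewrite -mulr_suml sum_message mul1r.
apply: eq_bigr => w _; rewrite -(marg_prod_pmf k a PS_pmf.2) mulr_sumr [RHS]big_mkcond/=.
apply: eq_bigr => s _; case: ifP => _; first exact: sum_output.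
by rewrite big1.
Qed.

Definition out (k : 'I_n) (o : Om) : Y := o.2 k.

(* Interpolates between [(W, S^n)] at [m = 0] and [(W, Y^n)] at [m = n]; one step
   adds [H(V_k, Y_k) - H(V_k, S_k)] for the variable [aux k] below. *)
Definition hybrid (m : nat) (o : Om) :=
  (o.1.1, [ffun i : 'I_n => if (i < m)%N then inr (o.2 i) else inl (o.1.2 i) : S + Y]).

(* [V_k = (W1, W2, Y^(k-1), S_(k+1)^n)], with [None] at position [k]. *)
Definition aux (k : 'I_n) (o : Om) :=
  (o.1.1, [ffun i : 'I_n => if (i < k)%N then Some (inr (o.2 i))
    else if i == k then None else Some (inl (o.1.2 i)) : option (S + Y)]).

Definition chan_in (k : 'I_n) (o : Om) : S * X1 * X2 :=
  (o.1.2 k, enc1 c k o.1.1.1 o.1.2 (past o.2 k), enc2 c k o.1.1.2 o.1.2 (past o.2 k)).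

Definition aux_law (k : 'I_n) v z : R :=
  marg code_law (fun o => (aux k o, chan_in k o)) (v, z).

(** Filling the hole of [aux k] with the output gives the information in [hybrid k.+1]; filling it
    with the state, as in [aux_state_ker], gives that in [hybrid k]. *)
Lemma aux_out_ker k o o' :
  ((aux k o, out k o) == (aux k o', out k o')) = (hybrid k.+1 o == hybrid k.+1 o').
Proof.
have ltkS (i : 'I_n) : (i < k.+1)%N = (i == k) || (i < k)%N by rewrite ltnS leq_eqVlt.
apply/eqP/eqP.
  move=> [ew /ffunP ev ey]; congr (_, _) => //; apply/ffunP => i.
  have := ev i; rewrite !ffunE ltkS.
  case: eqVneq => [->|_] /=; first by move: ey; rewrite /out => ->.
  by case: ifP => _ [->].
move=> [ew /ffunP et].
have ey : out k o = out k o' by have := et k; rewrite !ffunE ltnSn => -[].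
congr (_, _, _) => //; apply/ffunP => i.
have := et i; rewrite !ffunE ltkS.
case: eqVneq => [->|_] /=; first by rewrite ltnn.
by case: ifP => _ [->].
Qed.

Lemma aux_state_ker k o o' :
  ((aux k o, o.1.2 k) == (aux k o', o'.1.2 k)) = (hybrid k o == hybrid k o').
Proof.
apply/eqP/eqP.
  move=> [ew /ffunP ev es]; congr (_, _) => //; apply/ffunP => i.
  have := ev i; rewrite !ffunE.
  case: eqVneq => [->|_] /=; first by rewrite ltnn es.
  by case: ifP => _ [->].
move=> [ew /ffunP et].
have es : o.1.2 k = o'.1.2 k by have := et k; rewrite !ffunE ltnn => -[].
congr (_, _, _) => //; apply/ffunP => i.
have := et i; rewrite !ffunE; case: eqVneq => [->|_] /=; first by rewrite ltnn.
by case: ifP => _ [->].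
Qed.

(** The Markov relation between [aux k], the channel input and the output. For fixed messages and
    states the first two depend only on the outputs before [k], so [causal_factor] applies in spite
    of the feedback. *)
Lemma aux_law_channel k v z y :
  marg code_law (fun o => (aux k o, chan_in k o, out k o)) (v, z, y) =
  aux_law k v z * chan_of W z y.
Proof.
rewrite /aux_law /marg mulr_suml big_mkcond [RHS]big_mkcond/=.
rewrite [LHS]sum_pair [LHS]sum_pair [RHS]sum_pair [RHS]sum_pair.
apply: eq_bigr => w _; apply: eq_bigr => s _.
pose h (t : {ffun 'I_n -> Y}) : R :=
  ((aux k (w, s, t), chan_in k (w, s, t)) == (v, z))%:R.
have hk : depends_below k h.
  move=> t t' e; rewrite /h; congr (_ == _)%:R; congr (_, _).
    by congr (_, _); apply/ffunP => i; rewrite !ffunE; case: ifP => // ik; rewrite /= e.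
  by rewrite /chan_in /= (past_depends (y := t) (y' := t')).
have := causal_factor Y_gt0 (@step_prob_depends w s) (@step_prob_sum1 w s) y hk.
move=> /(congr1 (fun x => M^-1 * \prod_k PS (s k) * x)); rewrite !mulr_sumr.
move=> E; apply: etrans (etrans E _); apply: eq_bigr => t _.
  rewrite xpair_eqE /h /out; case: (_ == (v, z)); case: (_ == y) => /=;
    by rewrite !(mul0r, mulr0, mul1r).
rewrite /h; case: eqP => [[_ <-]|_]; last by rewrite !mul0r mulr0.
by rewrite mul1r step_prob_upd [LHS]mulrCA [LHS]mulrC.
Qed.

Lemma aux_law_feasible k : feasible state_of PS (aux_law k).
Proof.
split; first by move=> v z; apply: marg_ge0; exact: code_law_ge0.
move=> s; rewrite -(marg_state k) -[RHS]/(marg _ (fun o => state_of (chan_in k o)) s).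
rewrite (marg_comp _ (chan_in k)); apply: eq_bigr => z _.
by rewrite (marg_pair _ (aux k)).
Qed.

Lemma gain_aux_law k : gain state_of (chan_of W) (aux_law k) =
  entropy code_law (out k) + (entropy code_law (hybrid k) - entropy code_law (hybrid k.+1)).
Proof.
rewrite (gain_entropy state_of (chan_of_pmf W_channel) (aux_law_channel k)).
rewrite (eq_entropy_ker _ (aux_out_ker k)) -addrA; congr (_ + _).
by rewrite addrC; congr (_ - _); apply: eq_entropy_ker; exact: aux_state_ker.
Qed.

Let h := \sum_s nxlogx (PS s).

(** At index 0 the variable is equivalent to [(W, S^n)]: uniform messages and an independent
    memoryless state. *)
Lemma entropy_hybrid0 : entropy code_law (hybrid 0) = log2 M + n%:R * h.
Proof.
have hE k : \sum_o code_law o * log2 (PS (o.1.2 k)) = - h.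
  have := entropy_nxlogx code_law (fun o => o.1.2 k).
  under eq_bigr do rewrite marg_state.
  rewrite -/h => <-; rewrite entropyE opprK.
  by apply: eq_bigr => o _; rewrite marg_state.
rewrite entropyE.
have E o : code_law o * log2 (marg code_law (hybrid 0) (hybrid 0 o)) =
    code_law o * (- log2 M) + \sum_k code_law o * log2 (PS (o.1.2 k)).
  have := code_law_ge0 o; rewrite le_eqVlt => /predU1P[<-|o0].
    by rewrite !mul0r add0r big1// => k _; rewrite mul0r.
  rewrite -mulr_sumr -mulrDr; congr (_ * _).
  have PS0 k : 0 < PS (o.1.2 k).
    rewrite lt_neqAle PS_pmf.1 andbT eq_sym.
    apply: contraTneq o0 => e; rewrite /code_law (bigD1 k)//= e.
    by rewrite !(mul0r, mulr0) ltxx.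
  rewrite (@eq_marg_ker _ _ _ _ _ _ (fun o => o.1)); last first.
    move=> u; apply/eqP/eqP => [[e1 /ffunP e2]|e].
      have {}e2 : u.1.2 = o.1.2.
        by apply/ffunP => i; have := e2 i; rewrite !ffunE => -[].
      by rewrite (surjective_pairing u.1) e1 e2 -surjective_pairing.
    by rewrite /hybrid e; congr pair; apply/ffunP => i; rewrite !ffunE.
  have -> : marg code_law (fun o => o.1) o.1 = M^-1 * \prod_k PS (o.1.2 k).
    rewrite /marg big_mkcond sum_pair (bigD1 o.1)//= [X in _ + X]big1 ?addr0.
      by rewrite eqxx; case: (o.1) => w s; rewrite sum_output.
    by move=> a ao; rewrite (negbTE ao) big1.
  by rewrite log2M ?invr_gt0 ?prodr_gt0// log2V// log2_prod.
rewrite (eq_bigr _ (fun o _ => E o)) big_split/= -mulr_suml code_law_pmf.2 mul1r.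
rewrite opprD opprK exchange_big/=; congr (_ + _).
by under eq_bigr do rewrite hE; rewrite sumr_const card_ord mulNrn opprK mulr_natl.
Qed.

(* Gibbs' inequality against the product of the output marginals, tilted towards
   correct decoding; it combines Fano's inequality with the subadditivity of
   [H(Y^n)]. *)
Lemma fano : - 1 - err_prob PS W c * log2 M <=
  \sum_k entropy code_law (out k) - entropy code_law (hybrid n).
Proof.
pose f (o : Om) := (o.1.1, o.2).
(* For each output sequence, weight 1/2 goes to the decoded pair and [1/(2M)] to any other, at most
   1 in total. This costs one bit, plus [log2 M] on an error. *)
pose q (b : 'I_M1 * 'I_M2 * {ffun 'I_n -> Y}) : R :=
  \prod_k marg code_law (out k) (b.2 k) *
  (if dec c b.2 == b.1 then 2^-1 else (2 * M)^-1).
have out0 k b : 0 <= marg code_law (out k) b by apply: marg_ge0; exact: code_law_ge0.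
have t0 b : 0 < (if dec c b.2 == b.1 then 2^-1 else (2 * M)^-1 : R).
  by case: ifP => _; rewrite invr_gt0// mulr_gt0.
have outpos o k : 0 < code_law o -> 0 < marg code_law (out k) (o.2 k).
  by move=> o0; exact: (marg_gt0 (out k) code_law_ge0 o0).
have q_le1 : \sum_b q b <= 1.
  rewrite sum_pair exchange_big/= -(@sum_prod_pmf R Y n (fun k => marg code_law (out k))).
    apply: ler_sum => y _; rewrite /q/= -mulr_sumr ler_piMr ?prodr_ge0//.
    rewrite (bigD1 (dec c y))//= eqxx.
    rewrite (eq_bigr (fun=> 2^-1 * M^-1)); last first.
      by move=> w wd; rewrite eq_sym (negbTE wd) invfM.
    have : \sum_(w | w != dec c y) 2^-1 * M^-1 <= \sum_(w : 'I_M1 * 'I_M2) 2^-1 * M^-1 :> R.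
      rewrite [leRHS](bigID (fun w => w != dec c y))/= lerDl.
      by apply: sumr_ge0 => w' _; rewrite mulr_ge0 ?invr_ge0 ?ltW.
    rewrite -[in leRHS]mulr_sumr sum_message; lra.
  by move=> k; rewrite sum_marg code_law_pmf.2.
have := @gibbs R _ (marg code_law f) q _ _ _ _.
rewrite (sum_marg_mul _ f (fun b => log2 (marg code_law f b) - log2 (q b))) => H.
have {H} : 0 <= \sum_o code_law o * (log2 (marg code_law f (f o)) - log2 (q (f o))).
  apply: H.
  - by move=> b; apply: marg_ge0; exact: code_law_ge0.
  - by move=> b; rewrite mulr_ge0 ?prodr_ge0// ltW// t0.
  - move=> b fb; rewrite mulr_gt0 ?t0// prodr_gt0// => k _.
    have : exists2 o, 0 < code_law o & f o = b.
      apply: contrapT => no; move: fb; rewrite /marg big1 ?ltxx// => o /eqP ob.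
      apply/eqP; rewrite eq_le code_law_ge0 andbT leNgt; apply/negP => o0.
      by apply: no; exists o.
    by case=> o o0 <-; exact: outpos.
  - by rewrite sum_marg code_law_pmf.2.
have E o : code_law o * (log2 (marg code_law f (f o)) - log2 (q (f o))) =
    code_law o * log2 (marg code_law f (f o)) + code_law o
    - \sum_k code_law o * log2 (marg code_law (out k) (out k o))
    + code_law o * (dec c o.2 != o.1.1)%:R * log2 M.
  have := code_law_ge0 o; rewrite le_eqVlt => /predU1P[<-|o0].
    by rewrite !mul0r big1 ?subr0 ?addr0// => k _; rewrite mul0r.
  rewrite -mulr_sumr /q log2M; [|by apply: prodr_gt0 => k _; exact: outpos|exact: t0].
  rewrite log2_prod; last by move=> k; exact: outpos.
  have l2 : log2 2^-1 = - 1 :> R by rewrite log2V// /log2 mulfV// gt_eqF// ln2_gt0.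
  rewrite /=; case: eqP => _ /=; first by rewrite l2; ring.
  rewrite invfM log2M ?invr_gt0// l2 log2V//; ring.
rewrite (eq_bigr _ (fun o _ => E o)) !big_split/= sumrN -mulr_suml code_law_err.
rewrite code_law_pmf.2 exchange_big/=.
rewrite (eq_bigr (fun k => - entropy code_law (out k))); last first.
  by move=> k _; rewrite entropyE opprK.
rewrite sumrN opprK.
have -> : \sum_o code_law o * log2 (marg code_law f (f o)) = - entropy code_law (hybrid n).
  rewrite -[LHS]opprK -entropyE; congr (- _); apply: eq_entropy_ker => u v.
  apply/eqP/eqP => [[e1 e2]|[e1 /ffunP e2]].
    by rewrite /hybrid e1; congr pair; apply/ffunP => i; rewrite !ffunE ltn_ord e2.
  rewrite /f e1; congr pair; apply/ffunP => i.
  by have := e2 i; rewrite !ffunE ltn_ord => -[].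
by lra.
Qed.

Lemma converse : (0 < n)%N ->
  exists k, (1 - err_prob PS W c) * log2 M - 1 <=
    n%:R * (gain state_of (chan_of W) (aux_law k) - h).
Proof.
move=> n0; apply: contrapT => no.
have H k : n%:R * (gain state_of (chan_of W) (aux_law k) - h) <
    (1 - err_prob PS W c) * log2 M - 1.
  by rewrite ltNge; apply/negP => k_le; apply: no; exists k.
have n0R : 0 < n%:R :> R by rewrite ltr0n.
have : \sum_(k < n) n%:R * (gain state_of (chan_of W) (aux_law k) - h) <
    \sum_(k < n) ((1 - err_prob PS W c) * log2 M - 1).
  apply: ltr_sum => [|k _]; last exact: H.
  by apply/hasP; exists (Ordinal n0); rewrite ?mem_index_enum.
rewrite -mulr_sumr sumr_const card_ord -[ltRHS]mulr_natl ltr_pM2l// sumrB.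
rewrite sumr_const card_ord.
under eq_bigr do rewrite gain_aux_law.
rewrite big_split/= -(big_mkord xpredT (fun k => entropy code_law (hybrid k) -
  entropy code_law (hybrid k.+1))).
(* The sum telescopes to [H(W, S^n) - H(W, Y^n)]; the [n * h] in its first term cancels the
   subtracted state entropies. *)
have -> : \sum_(0 <= k < n) (entropy code_law (hybrid k) - entropy code_law (hybrid k.+1))
    = entropy code_law (hybrid 0) - entropy code_law (hybrid n).
  rewrite -[RHS]opprB -(telescope_sumr (fun k => entropy code_law (hybrid k)) (leq0n n)) -sumrN.
  by apply: eq_bigr => k _; rewrite opprB.
rewrite entropy_hybrid0 -[h *+ n]mulr_natl.
by have := fano; lra.
Qed.

End Converse.

(** * Achievable rates *)

(** Rounding up leaves at least one message even at a negative rate, whence the positive part. *)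
Lemma log2_nmsg (R : realType) n (r : R) :
  (0 < @nmsg R n r)%N /\ n%:R * Num.max r 0 <= log2 ((@nmsg R n r)%:R : R).
Proof.
pose x : R := 2 `^ (n%:R * r).
have x0 : 0 < x by exact: powR_gt0.
have xm : x <= (nmsg n r)%:R.
  rewrite natr_absz ger0_norm; first exact: ceil_ge.
  by rewrite -(ler_int R) (le_trans (ltW x0))// ceil_ge.
have m0 : (0 < @nmsg R n r)%N by rewrite -(ltr_nat R) (lt_le_trans x0).
split => //; have ln2 := @ln2_gt0 R.
have m1 : 0 <= log2 ((@nmsg R n r)%:R : R) by rewrite /log2 divr_ge0 ?(ltW ln2)// ln_ge0 ?ler1n.
case: (leP r 0) => r0; first by rewrite mulr0.
rewrite /log2 ler_pdivlMr// -ln_powR ler_ln ?posrE//.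
exact: lt_le_trans xm.
Qed.

(** At time 0 the encoders turn the empty past into a channel input, and the output law there has
    mass 1. *)
Lemma code_output_gt0 (R : realType) (X1 X2 S Y : finType) (PS : S -> R)
    (W : X1 -> X2 -> S -> Y -> R) n M1 M2 (c : fbcode X1 X2 S Y n M1 M2) :
  is_pmf PS -> is_channel W -> (0 < n)%N -> (0 < M1)%N -> (0 < M2)%N -> (0 < #|Y|)%N.
Proof.
move=> PS_pmf W_channel n0 m1 m2.
have [s0|S0] := pickP (xpredT : pred S); last first.
  by have := PS_pmf.2; rewrite big_pred0// => /esym/eqP; rewrite oner_eq0.
move=> _; pose k := Ordinal n0; pose y0 : {ffun 'I_k -> Y} := ffun0 (card_ord 0).
rewrite lt0n; apply/negP => /eqP/card0_eq Y0.
have := (W_channel (enc1 c k (Ordinal m1) [ffun=> s0] y0)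
  (enc2 c k (Ordinal m2) [ffun=> s0] y0) s0).2.
by rewrite big_pred0 => [/esym/eqP|y]; [rewrite oner_eq0|have := Y0 y; rewrite inE].
Qed.

Lemma achievable_gain (R : realType) (X1 X2 S Y : finType) (PS : S -> R)
    (W : X1 -> X2 -> S -> Y -> R) (r1 r2 : R) d :
  is_pmf PS -> is_channel W -> (#|{: S * X1 * X2}| <= d)%N -> achievable PS W r1 r2 ->
  forall eps, 0 < eps -> exists2 mu : 'I_d -> S * X1 * X2 -> R,
    feasible state_of PS mu &
    Num.max r1 0 + Num.max r2 0 - eps <=
      gain state_of (chan_of W) mu - \sum_s nxlogx (PS s).
Proof.
move=> PS_pmf W_channel Zd [c cE] eps eps0.
set rho := Num.max r1 0 + Num.max r2 0.
have rho0 : 0 <= rho by rewrite addr_ge0// le_max lexx orbT.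
have e0 : 0 < 2 * (rho + eps) by rewrite mulr_gt0// ltr_wpDl.
(* This error level makes the loss [e1 * rho] at most [eps / 2]; the other half, with [n * eps] at
   least 2, absorbs the one bit lost in [converse]. *)
have [N Nc] := cE (eps / (2 * (rho + eps))) (divr_gt0 eps0 e0).
pose n := maxn N (Num.bound (2 / eps)).+1.
have n0 : (0 < n)%N by rewrite leq_max orbT.
have nR : 0 < n%:R :> R by rewrite ltr0n.
have n_eps : 2 <= n%:R * eps.
  rewrite -ler_pdivrMr//; apply: (@le_trans _ _ (Num.bound (2 / eps))%:R).
    by apply/ltW/archi_boundP; rewrite divr_ge0// ltW.
  by rewrite ler_nat leq_max leqnSn orbT.
have [m1 M1] := log2_nmsg n r1; have [m2 M2] := log2_nmsg n r2.
have Y0 := code_output_gt0 (c n) PS_pmf W_channel n0 m1 m2.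
have [k] := converse PS_pmf W_channel (c n) m1 m2 Y0 n0.
have [mu fmu gmu] := gain_le_bounded_card (chan_of_pmf W_channel) Zd
  (aux_law_feasible PS_pmf W_channel (c n) m1 m2 Y0 k).
move=> kE; exists mu => //.
have Pe := Nc n (leq_maxl _ _).
apply: le_trans (lerB gmu (lexx _)).
rewrite -(ler_pM2l nR); apply: le_trans kE.
have Mrho : n%:R * rho <= log2 (nmsg n r1 * nmsg n r2)%:R.
  by rewrite natrM log2M ?ltr0n// mulrDr lerD.
set e1 := eps / _ in Pe.
have e1rho : e1 * rho <= eps / 2.
  rewrite /e1 mulrAC ler_pdivrMr// -subr_ge0.
  have -> : eps / 2 * (2 * (rho + eps)) - eps * rho = eps ^+ 2 by field.
  by rewrite sqr_ge0.
have e1_le1 : e1 <= 1.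
  by rewrite /e1 ler_pdivrMr// mul1r; lra.
apply: (@le_trans _ _ ((1 - e1) * (n%:R * rho) - 1)).
  have := ler_wpM2l (ltW nR) e1rho.
  by nra.
rewrite lerD2r; apply: (@le_trans _ _ ((1 - e1) * log2 (nmsg n r1 * nmsg n r2)%:R)).
  by rewrite ler_wpM2l// subr_ge0.
rewrite ler_wpM2r ?lerB//; apply: le_trans Mrho.
by rewrite mulr_ge0// ltW.
Qed.

Theorem theorem2 (R : realType) (X1 X2 S Y : finType)
  (PS : S -> R) (W : X1 -> X2 -> S -> Y -> R) :
  is_pmf PS -> is_channel W ->
  capacity_region PS W `<=` outer_region PS W.
Proof.
move=> PS_pmf W_channel [r1 r2] r_closure.
(* The successor equips ['I_d] with the addition modulo [d] used by the one-time pad. *)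
set d := #|{: S * X1 * X2}|.+1; set h := \sum_s nxlogx (PS s).
have approx eps : 0 < eps -> exists2 mu : 'I_d -> S * X1 * X2 -> R,
    feasible state_of PS mu &
    Num.max r1 0 + Num.max r2 0 - eps <= gain state_of (chan_of W) mu - h.
  (* One third for each coordinate of the approximating pair, one for [achievable_gain]. *)
  move=> eps0; have e3 : 0 < eps / 3 by rewrite divr_gt0.
  have [[q1 q2] [/= achq [/= b1 b2]]] := r_closure _ (nbhsx_ballx (r1, r2) _ e3).
  have [mu fmu mu_ge] := achievable_gain PS_pmf W_channel (leqnSn _) achq e3.
  exists mu => //; apply: le_trans mu_ge.
  have maxE (x y e : R) : ball x e y -> Num.max x 0 <= Num.max y 0 + e.
    rewrite /ball/= => xy; have e0 := le_lt_trans (normr_ge0 _) xy.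
    move: xy; rewrite ltr_norml => /andP[_ xy].
    rewrite ge_max; apply/andP; split.
      have : y <= Num.max y 0 by rewrite le_max lexx.
      lra.
    by apply: addr_ge0; [rewrite le_max lexx orbT|exact: ltW].
  have := maxE _ _ _ b1; have := maxE _ _ _ b2; lra.
have [mu0 fmu0 _] := approx 1 ltr01.
have [mu fmu mu_max] := gain_attains_max (chan_of W) PS_pmf fmu0.
have G_ge : Num.max r1 0 + Num.max r2 0 <= gain state_of (chan_of W) mu - h.
  apply/ler_addgt0Pr => eps eps0; have [mu' fmu' mu'_ge] := approx eps eps0.
  by have := mu_max _ fmu'; lra.
have r1_le : r1 <= Num.max r1 0 by rewrite le_max lexx.
have r2_le : r2 <= Num.max r2 0 by rewrite le_max lexx.
have r1_ge0 : 0 <= Num.max r1 0 by rewrite le_max lexx orbT.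
have r2_ge0 : 0 <= Num.max r2 0 by rewrite le_max lexx orbT.
by apply: (one_time_pad PS_pmf W_channel fmu); rewrite -/h; lra.
Qed.
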